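(* Let $a,c,t\in\mathbb{C}$ with $c\notin\{0,-1,-2,\dots\}$, put $\beta:=\frac{a+c-1}{2}$ and $$\tau_{\pm}:=1-2t\pm2\sqrt{t(t-1)},$$ i.e. $\tau_++\tau_-=2-4t$ and $\tau_+\tau_-=1$. Then for all $x\in\mathbb{C}$ sufficiently close to $0$, $$F_1(a;\beta,\beta;c;\tau_+x,\tau_-x)=(1-x)^{-2\beta}F_1\left(\beta;\tfrac{c-a}{2},a;c;\frac{-4x}{(1-x)^2},\frac{-4xt}{(1-x)^2}\right).$$
   Context: $(q)_n=q(q+1)\cdots(q+n-1)$, $(q)_0=1$. Appell's function $F_1$ is, for $|X|,|Y|<1$ and $c\notin\{0,-1,-2,\dots\}$, $F_1(a;b_1,b_2;c;X,Y):=\sum_{j,k\ge0}\frac{(a)_{j+k}}{(c)_{j+k}}\frac{(b_1)_j(b_2)_k}{j!\,k!}X^jY^k$. The power $(1-x)^{-2\beta}$ is the branch with value $1$ at $x=0$. *)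

(* Defs.v *)
From mathcomp Require Import all_boot all_order all_algebra.
From mathcomp Require Import all_classical all_reals all_analysis.
From mathcomp Require Import complex.
From mathcomp.analysis.showcase Require summability.

Set Implicit Arguments.
Unset Strict Implicit.
Unset Printing Implicit Defensive.

Import Order.TTheory GRing.Theory Num.Theory.
Import numFieldNormedType.Exports.

Local Open Scope ring_scope.
Local Open Scope complex_scope.

(* The rising factorial q (q + 1) ... (q + n - 1). *)
Definition pochhammer (K : pzRingType) (q : K) (n : nat) : K :=
  \prod_(i < n) (q + i%:R).

Definition appellF1_term (R : realType) (a b1 b2 c X Y : R[i])
    (jk : nat * nat) : R[i] :=
  pochhammer a (jk.1 + jk.2) / pochhammer c (jk.1 + jk.2)
  * (pochhammer b1 jk.1 * pochhammer b2 jk.2 / (jk.1`!%:R * jk.2`!%:R))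
  * X ^+ jk.1 * Y ^+ jk.2.

(* The unconditional sum over nat * nat: the limit of the partial sums over
   the finite sets of indices, directed by inclusion. It is meaningful when
   `|X|, `|Y| < 1 and c is not a nonpositive integer; elsewhere it may be a
   default value. R[i]^o is R[i], seen as a normed space over itself. *)
Definition appellF1 (R : realType) (a b1 b2 c X Y : R[i]) : R[i] :=
  summability.sum (appellF1_term a b1 b2 c X Y : _ -> R[i]^o).

Definition cexp (R : realType) (z : R[i]) : R[i] :=
  (expR (complex.Re z))%:C * (cos (complex.Im z) +i* sin (complex.Im z)).

(* The principal logarithm, on the half-plane Re z > 0 only: there the
   principal argument of z is atan (Im z / Re z). *)
Definition clog (R : realType) (z : R[i]) : R[i] :=
  ln (ComplexField.Normc.normc z) +i* atan (complex.Im z / complex.Re z).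

(* The principal power on Re z > 0. As `|x| < 1 implies Re (1 - x) > 0,
   x |-> cpow (1 - x) s is, on the unit disc, the branch of (1 - x)^s
   with value 1 at x = 0. *)
Definition cpow (R : realType) (z s : R[i]) : R[i] := cexp (s * clog z).

(* Main.v *)
Require Import Defs.
From mathcomp Require Import all_boot all_order all_algebra.
From mathcomp Require Import all_classical all_reals all_analysis.
From mathcomp Require Import complex finmap zify ring lra.

Import Order.TTheory GRing.Theory Num.Theory.
Import numFieldNormedType.Exports.

Set Implicit Arguments.
Unset Strict Implicit.
Unset Printing Implicit Defensive.

(** Both sides are power series in x, and the coefficients agree.

    Write b for (a + c - 1) / 2. On the left, the coefficient of x^n is
    (a)_n / (c)_n times a Cauchy product of two binomial series, that is, the
    coefficient of x^n in ((1 - taup x) (1 - taum x))^(-b). As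
    (1 - taup x) (1 - taum x) = (1 - x)^2 + 4 t x, this is also the coefficient
    in (1 - x)^(-2b) (1 + 4 t x / (1 - x)^2)^(-b), which expands in powers
    of t ([gegenbauerE]). On the right, the binomial series
    of (1 - x)^(-2b - 2(m + k)) ([has_sum_cpow]) turns the double series into a
    triple one ([has_sum_triple_row]); after sorting by powers of x and t, the
    coefficient of x^n t^k is, up to an explicit factor, a terminating balanced
    3F2 at 1, and Saalschutz's theorem ([saalschutz]) sums it to the coefficient
    found on the left ([diagonal_coef_eq]).

    The analysis consists in rearranging sums. [has_sum] is unconditional
    convergence, for which summing along the fibers of any map preserves the
    value ([has_sum_partition]), so the only estimate needed is one that makes
    the sums exist ([has_sum_appellF1], [has_sum_triple]). The crude bounds
    used are geometric and hold in a small disc around 0, which is all that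
    the statement asks for. The branch of the power enters only through its
    binomial series, proved by integrating along the segment from 0 to x the
    differential equation that both sides satisfy ([exp_ode_const]). *)

Local Open Scope ring_scope.
Local Open Scope complex_scope.

(** * Coefficients of the binomial series *)

Section Algebra.
Variable K : numFieldType.
Implicit Types (q a b c t s : K) (n m k l : nat).

Lemma pochhammer0 q : pochhammer q 0 = 1.
Proof. by rewrite /pochhammer big_ord0. Qed.

Lemma pochhammerS q n : pochhammer q n.+1 = pochhammer q n * (q + n%:R).
Proof. by rewrite /pochhammer big_ord_recr. Qed.

Lemma pochhammerD q m n :
  pochhammer q (m + n) = pochhammer q m * pochhammer (q + m%:R) n.
Proof.
elim: n => [|n IHn]; first by rewrite addn0 pochhammer0 mulr1.
by rewrite addnS !pochhammerS IHn natrD addrA mulrA.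
Qed.

Lemma pochhammerSl q n : pochhammer q n.+1 = q * pochhammer (q + 1) n.
Proof. by rewrite -add1n pochhammerD pochhammerS pochhammer0 mul1r addr0. Qed.

Lemma pochhammer_neq0 c n : (forall i, c <> - i%:R) -> pochhammer c n != 0.
Proof.
move=> hc; apply/prodf_neq0 => i _.
by rewrite addr_eq0; apply/eqP.
Qed.

(** The coefficient of x^l in (1 - x)^(-q). *)
Definition binser q l := pochhammer q l / l`!%:R.

Lemma natrS_neq0 n : n.+1%:R != 0 :> K.
Proof. by rewrite pnatr_eq0. Qed.

Lemma fact_neq0 n : n`!%:R != 0 :> K.
Proof. by rewrite pnatr_eq0 -lt0n fact_gt0. Qed.

Lemma binser0 q : binser q 0 = 1.
Proof. by rewrite /binser pochhammer0 divr1. Qed.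

Lemma binserS q n : binser q n.+1 = binser q n * (q + n%:R) / n.+1%:R.
Proof.
rewrite /binser pochhammerS factS natrM.
by field; rewrite ?nat1r ?natr1 natrS_neq0 fact_neq0.
Qed.

Lemma binserSl q n : binser q n.+1 = q * binser (q + 1) n / n.+1%:R.
Proof.
rewrite /binser pochhammerSl factS natrM.
by field; rewrite ?nat1r ?natr1 natrS_neq0 fact_neq0.
Qed.

(** * The generating function of the Gegenbauer polynomials *)

Lemma three_term_unique (u v : nat -> K) (p r : nat -> K) :
  (forall n, n.+2%:R * u n.+2 = p n * u n.+1 - r n * u n) ->
  (forall n, n.+2%:R * v n.+2 = p n * v n.+1 - r n * v n) ->
  u 0%N = v 0%N -> u 1%N = v 1%N -> u =1 v.
Proof.
move=> hu hv h0 h1 n.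
suff [] : u n = v n /\ u n.+1 = v n.+1 by [].
elim: n => [//|n [IH0 IH1]]; split=> //.
by apply: (mulfI (natrS_neq0 n.+1)); rewrite hu hv IH0 IH1.
Qed.

Definition convolution (u v : nat -> K) n := \sum_(i < n.+1) u i * v (n - i)%N.

(** Weighting by the index is the derivation x d/dx, so this is Leibniz' rule. *)
Lemma convolution_weight (u v : nat -> K) n :
  n%:R * convolution u v n =
  convolution (fun i => i%:R * u i) v n + convolution u (fun i => i%:R * v i) n.
Proof.
rewrite /convolution mulr_sumr -big_split; apply: eq_bigr => i _ /=.
have {1}-> : n = (i + (n - i))%N by rewrite subnKC // -ltnS.
by rewrite natrD; ring.
Qed.

(** The hypothesis on u is the differential equation
    (1 - x X) U' = q x U of U = (1 - x X)^(-q), read on coefficients. *)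
Lemma convolution_weightl (u v : nat -> K) n q x :
  (forall i, u i.+1 = u i * (q + i%:R) * x / i.+1%:R) ->
  convolution (fun i => i%:R * u i) v n.+1 =
  x * (q * convolution u v n + convolution (fun i => i%:R * u i) v n).
Proof.
move=> hu; rewrite /convolution big_ord_recl mul0r mul0r add0r mulr_sumr -big_split.
rewrite mulr_sumr; apply: eq_bigr => i _ /=.
rewrite /bump /= add1n subSS hu.
by field; rewrite ?nat1r ?natr1 natrS_neq0.
Qed.

Lemma convolutionC (u v : nat -> K) n : convolution u v n = convolution v u n.
Proof.
rewrite /convolution (reindex_inj rev_ord_inj) /=; apply: eq_bigr => i _.
by rewrite subSS subKn ?(leq_ord i) //; apply: mulrC.
Qed.

(** Coefficient form of
    (1 - x X) (1 - y X) F' = q (x + y - 2 x y X) F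
    for F = ((1 - x X) (1 - y X))^(-q). *)
Lemma gegenbauer_rec q x y n :
  let u i := binser q i * x ^+ i in
  let v i := binser q i * y ^+ i in
  n.+2%:R * convolution u v n.+2 = (n.+1%:R + q) * (x + y) * convolution u v n.+1
    - (n%:R + 2%:R * q) * (x * y) * convolution u v n.
Proof.
move=> u v.
have hu i : u i.+1 = u i * (q + i%:R) * x / i.+1%:R.
  by rewrite /u binserS exprS; ring.
have hv i : v i.+1 = v i * (q + i%:R) * y / i.+1%:R.
  by rewrite /v binserS exprS; ring.
have hl := convolution_weightl v _ hu.
have hr m : convolution u (fun i => i%:R * v i) m.+1 =
    y * (q * convolution u v m + convolution u (fun i => i%:R * v i) m).
  by rewrite convolutionC (convolution_weightl u _ hv) (convolutionC v) (convolutionC _ u).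
have h0 := convolution_weight u v n.
have h1 := convolution_weight u v n.+1.
have h2 := convolution_weight u v n.+2.
move: h1 h2; rewrite !hl !hr => h1 h2; rewrite h2.
move: h0 h1.
set G0 := convolution u v n; set G1 := convolution u v n.+1.
set A := convolution (fun _ => _) _ _; set B := convolution u _ _ => h0 h1.
have -> : (n.+1%:R + q) * (x + y) * G1 = (x + y) * (n.+1%:R * G1) + q * (x + y) * G1.
  by ring.
have -> : (n%:R + 2%:R * q) * (x * y) * G0 = x * y * (n%:R * G0 + 2%:R * q * G0).
  by ring.
by rewrite h0 h1; ring.
Qed.

(** The coefficient of x^n (-4t)^k in
    (1 - x)^(-2q) (1 + 4 t x / (1 - x)^2)^(-q); the value 0 for k > n makes the
    recurrences below hold without boundary terms. *)
Definition gegen_coef q n k :=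
  if (k <= n)%N then binser q k * binser (2%:R * q + 2%:R * k%:R) (n - k) else 0.

Lemma gegen_coef_rec0 q n :
  n.+2%:R * gegen_coef q n.+2 0 - 2%:R * (n.+1%:R + q) * gegen_coef q n.+1 0
    + (n%:R + 2%:R * q) * gegen_coef q n 0 = 0.
Proof.
rewrite /gegen_coef /= !subn0 mulr0 addr0 !binserS.
by field; rewrite ?nat1r ?natr1 -?natrD !natrS_neq0.
Qed.

Lemma gegen_coef_recS q n k :
  n.+2%:R * gegen_coef q n.+2 k.+1 - 2%:R * (n.+1%:R + q) * gegen_coef q n.+1 k.+1
    + (n%:R + 2%:R * q) * gegen_coef q n k.+1 = (n.+1%:R + q) * gegen_coef q n.+1 k.
Proof.
rewrite /gegen_coef.
(* For k < n the four coefficients have binser q k * binser (2 q + 2 (k + 1)) p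
   as a common factor, where n = k + 1 + p; at k = n and k = n + 1 some of
   them vanish, and for k > n + 1 all of them. *)
have [ltkn|] := ltnP k n.
  have [-> -> ->] : [/\ k < n.+2, k < n.+1 & k <= n.+1]%N by split; lia.
  have [p ->] : exists p, n = (k.+1 + p)%N by exists (n - k.+1)%N; rewrite subnKC.
  have -> : ((k.+1 + p).+2 - k.+1 = p.+2)%N by lia.
  have -> : ((k.+1 + p).+1 - k.+1 = p.+1)%N by lia.
  have -> : ((k.+1 + p) - k.+1 = p)%N by lia.
  have -> : ((k.+1 + p).+1 - k = p.+2)%N by lia.
  rewrite (binserSl (_ + 2%:R * k%:R)) (binserSl (_ + 1)).
  have -> : 2%:R * q + 2%:R * k%:R + 1 + 1 = 2%:R * q + 2%:R * k.+1%:R.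
    by rewrite -[k.+1%:R]natr1; ring.
  rewrite !binserS.
  by field; rewrite ?nat1r ?natr1 -?natrD ?nat1r !pnatr_eq0.
rewrite leq_eqVlt => /predU1P[<-|].
  have [-> -> ->] : [/\ n < n.+2, n < n.+1 & n <= n.+1]%N by split; lia.
  have [-> -> ->] : [/\ n.+2 - n.+1 = 1, n.+1 - n.+1 = 0 & n.+1 - n = 1]%N by split; lia.
  rewrite !binserS !binser0.
  by field; rewrite ?nat1r ?natr1 -?natrD ?nat1r !pnatr_eq0.
rewrite leq_eqVlt => /predU1P[<-|ltnk].
  rewrite ltnSn ltnn leqnn !subnn !binserS !binser0.
  by field; rewrite ?nat1r ?natr1 -?natrD ?nat1r !pnatr_eq0.
have -> : (k < n.+2)%N = false by lia.
have -> : (k < n.+1)%N = false by lia.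
have -> : (k <= n.+1)%N = false by lia.
by rewrite !mulr0 subrr addr0.
Qed.

Definition gegen_poly q t n := \sum_(k < n.+1) gegen_coef q n k * (- 4%:R * t) ^+ k.

Lemma gegen_poly_widen q t n m : (n <= m)%N ->
  gegen_poly q t n = \sum_(k < m.+1) gegen_coef q n k * (- 4%:R * t) ^+ k.
Proof.
move=> lenm; rewrite /gegen_poly -!(big_mkord xpredT (fun k => gegen_coef q n k * _ ^+ k)).
rewrite [RHS](big_cat_nat _ (n := n.+1)) //= [X in _ + X]big_nat_cond.
by rewrite [X in _ + X]big1 ?addr0 // => k /andP[/andP[ltnk _] _];
  rewrite /gegen_coef leqNgt ltnk mul0r.
Qed.

Lemma gegen_poly_rec q t n :
  n.+2%:R * gegen_poly q t n.+2 = (n.+1%:R + q) * (2%:R - 4%:R * t) * gegen_poly q t n.+1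
    - (n%:R + 2%:R * q) * gegen_poly q t n.
Proof.
suff e : n.+2%:R * gegen_poly q t n.+2 - 2%:R * (n.+1%:R + q) * gegen_poly q t n.+1
    + (n%:R + 2%:R * q) * gegen_poly q t n =
    (- 4%:R * t) * (n.+1%:R + q) * gegen_poly q t n.+1.
  by apply/eqP; rewrite -subr_eq0; apply/eqP; move/eqP: e;
     rewrite -subr_eq0 => /eqP <-; ring.
rewrite [in RHS]/gegen_poly (gegen_poly_widen q t (leqnSn n.+1))
  (gegen_poly_widen q t (leqW (leqnSn n))).
rewrite [gegen_poly q t n.+2]/gegen_poly !mulr_sumr -sumrB -big_split /=.
rewrite big_ord_recl /= expr0 !mulr1.
rewrite gegen_coef_rec0 add0r; apply: eq_bigr => k _; rewrite /bump /= add1n exprS.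
have := gegen_coef_recS q n k.
set a0 := gegen_coef _ _ _; set a1 := gegen_coef _ _ _; set a2 := gegen_coef _ _ _.
set a3 := gegen_coef _ _ _ => h.
transitivity ((- 4%:R * t) * (- 4%:R * t) ^+ k * ((n.+1%:R + q) * a3)).
  by rewrite -h; ring.
by ring.
Qed.

(** Both sides obey the same three-term recurrence, because the two points
    have product 1 and sum 2 - 4 t. *)
Lemma gegenbauerE q t s n : s ^+ 2 = t * (t - 1) ->
  convolution (fun i => binser q i * (1 - 2%:R * t + 2%:R * s) ^+ i)
       (fun i => binser q i * (1 - 2%:R * t - 2%:R * s) ^+ i) n = gegen_poly q t n.
Proof.
move=> hs; set x := _ + 2%:R * s; set y := _ - 2%:R * s.
have hxy : x * y = 1.
  have -> : x * y = 1 - 4%:R * t + 4%:R * t ^+ 2 - 4%:R * s ^+ 2.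
    by rewrite /x /y; ring.
  by rewrite hs; ring.
have hxD : x + y = 2%:R - 4%:R * t by rewrite /x /y; ring.
move: n; apply: (@three_term_unique _ _
    (fun n => (n.+1%:R + q) * (2%:R - 4%:R * t)) (fun n => n%:R + 2%:R * q)).
- by move=> n; rewrite gegenbauer_rec hxD hxy mulr1.
- exact: gegen_poly_rec.
- by rewrite /convolution /gegen_poly !big_ord1 /gegen_coef /= !binser0 !expr0 !mulr1.
rewrite /convolution /gegen_poly !big_ord_recl !big_ord0 /gegen_coef /= /bump /=.
rewrite !binserS !binser0.
rewrite !expr0 !expr1 -[(- 4%:R * t)]/(- 4%:R * t).
have -> : - 4%:R * t = x + y - 2%:R by rewrite hxD; ring.
by field.
Qed.

(** * Saalschutz's theorem *)

(** The m-th term of Saalschutz's sum, with top parameters - N, a + c - 1 + N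
    and (c - a) / 2 and bottom parameters c and (a + c) / 2. Writing it with
    binomial coefficients of parameter a + c - 1 + 2m instead avoids
    dividing by the rising factorials of (a + c) / 2, which may vanish. *)
Definition saal_term a c m N :=
  (- 4%:R) ^+ m * pochhammer ((a + c - 1) / 2%:R) m * pochhammer ((c - a) / 2%:R) m
  / (pochhammer c m * m`!%:R) * binser (a + c - 1 + 2%:R * m%:R) (N - m).

(** The companion of [saal_term] produced by Zeilberger's algorithm: the
    recurrence in N satisfied by the sum, applied to the m-th term, is the
    difference of two consecutive values of it. *)
Definition saal_cert a c j N :=
  2%:R * (- 4%:R) ^+ j * pochhammer ((a + c - 1) / 2%:R) j
  * pochhammer ((c - a) / 2%:R) j.+1 / (pochhammer c j * j`!%:R)
  * ((N - j).+1%:R * binser (a + c - 1 + 2%:R * j%:R) (N - j).+1).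

Lemma saal_cert0 a c N :
  (c + N%:R) * N.+1%:R * saal_term a c 0 N.+1
    - (a + N%:R) * (a + c - 1 + N%:R) * saal_term a c 0 N = saal_cert a c 0 N.
Proof.
rewrite /saal_term /saal_cert !pochhammer0 !pochhammerS !pochhammer0 !subn0 !binserS.
by field; rewrite /= ?nat1r ?natr1 -?natrD ?nat1r !pnatr_eq0.
Qed.

Lemma saal_certS a c j N : (forall i : nat, c <> - i%:R) -> (j < N)%N ->
  (c + N%:R) * N.+1%:R * saal_term a c j.+1 N.+1
    - (a + N%:R) * (a + c - 1 + N%:R) * saal_term a c j.+1 N =
  saal_cert a c j.+1 N - saal_cert a c j N.
Proof.
move=> hc lejN; rewrite /saal_term /saal_cert.
have [p ->] : exists p, N = (j.+1 + p)%N by exists (N - j.+1)%N; rewrite subnKC.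
have -> : ((j.+1 + p).+1 - j.+1 = p.+1)%N by lia.
have -> : (j.+1 + p - j.+1 = p)%N by lia.
have -> : (j.+1 + p - j = p.+1)%N by lia.
rewrite (binserSl (_ + 2%:R * j%:R)) (binserSl (_ + 1)).
have -> : a + c - 1 + 2%:R * j%:R + 1 + 1 = a + c - 1 + 2%:R * j.+1%:R.
  by rewrite -[j.+1%:R]natr1; ring.
have hp := pochhammer_neq0 j hc.
have hcj : c + j%:R != 0 by rewrite addr_eq0; apply/eqP.
rewrite !binserS !(pochhammerS _ j) (pochhammerS _ j.+1) !(pochhammerS _ j) exprS factS natrM.
have hf := fact_neq0 j.
move: (pochhammer c j) (pochhammer _ j) (pochhammer _ j) (binser _ _) (_ ^+ j) j`! hp hf
  => p1 p2 p3 p4 p5 f hp hf.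
by field; rewrite /= ?hf ?hp ?hcj ?nat1r ?natr1 -?natrD ?nat1r ?pnatr_eq0.
Qed.

Lemma saal_cert_last a c N : (forall i : nat, c <> - i%:R) ->
  (c + N%:R) * N.+1%:R * saal_term a c N.+1 N.+1 = - saal_cert a c N N.
Proof.
move=> hc; rewrite /saal_term /saal_cert !subnn binserS !binser0.
have hp := pochhammer_neq0 N hc.
have hcN : c + N%:R != 0 by rewrite addr_eq0; apply/eqP.
rewrite !pochhammerS exprS factS natrM.
have hf := fact_neq0 N.
move: (pochhammer c N) (pochhammer _ N) (pochhammer _ N) (_ ^+ N) N`! hp hf
  => p1 p2 p3 p5 f hp hf.
by field; rewrite /= ?hf ?hp ?hcN ?nat1r ?natr1 -?natrD ?nat1r ?pnatr_eq0.
Qed.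

(** The telescoping certificate shows that the sum satisfies a first-order
    recurrence in N, which the closed form also satisfies. *)
Lemma saalschutz a c N : (forall i : nat, c <> - i%:R) ->
  \sum_(m < N.+1) saal_term a c m N =
  pochhammer a N / pochhammer c N * binser (a + c - 1) N.
Proof.
move=> hc; elim: N => [|N IHN].
  by rewrite big_ord1 /saal_term !pochhammer0 !binser0 expr0 fact0 ?divr1 ?mulr1 ?invr1 ?mulr1.
have hcN : c + N%:R != 0 by rewrite addr_eq0; apply/eqP.
have hp := pochhammer_neq0 N hc.
suff e : (c + N%:R) * N.+1%:R * \sum_(m < N.+2) saal_term a c m N.+1 =
    (a + N%:R) * (a + c - 1 + N%:R) * \sum_(m < N.+1) saal_term a c m N.
  apply: (mulfI (mulf_neq0 hcN (natrS_neq0 N))); rewrite e IHN !pochhammerS binserS.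
  by field; rewrite hcN hp ?nat1r ?natr1 natrS_neq0.
have telescope m : (m <= N)%N ->
    (c + N%:R) * N.+1%:R * (\sum_(i < m.+1) saal_term a c i N.+1) -
    (a + N%:R) * (a + c - 1 + N%:R) * (\sum_(i < m.+1) saal_term a c i N) =
    saal_cert a c m N.
  elim: m => [|m IHm] lemN; first by rewrite !big_ord1 saal_cert0.
  rewrite [\sum_(i < m.+2) saal_term a c i N.+1]big_ord_recr.
  rewrite [\sum_(i < m.+2) saal_term a c i N]big_ord_recr /=.
  rewrite [_ * N.+1%:R * (_ + _)]mulrDr [_ * _ * (_ + saal_term _ _ _ N)]mulrDr opprD addrACA.
  by rewrite IHm ?(ltnW lemN) // saal_certS //; ring.
by rewrite big_ord_recr mulrDr /= saal_cert_last // -(telescope N (leqnn N)) opprB addrC subrK.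
Qed.

(** * Comparison of the coefficients *)

(** For fixed k, the sum over m is Saalschutz's sum with a and c shifted by k. *)
Lemma diagonal_coef_eq a c t s n : (forall i : nat, c <> - i%:R) -> s ^+ 2 = t * (t - 1) ->
  let b := (a + c - 1) / 2%:R in
  \sum_(k < n.+1) \sum_(m < (n - k).+1)
     pochhammer b (m + k) / pochhammer c (m + k)
       * (pochhammer ((c - a) / 2%:R) m * pochhammer a k / (m`!%:R * k`!%:R))
       * (- 4%:R) ^+ (m + k) * t ^+ k
       * binser (2%:R * b + 2%:R * (m + k)%:R) (n - k - m) =
  pochhammer a n / pochhammer c n *
   convolution (fun i => binser b i * (1 - 2%:R * t + 2%:R * s) ^+ i)
       (fun i => binser b i * (1 - 2%:R * t - 2%:R * s) ^+ i) n.
Proof.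
move=> hc hs b; rewrite gegenbauerE // /gegen_poly mulr_sumr; apply: eq_bigr => k _.
have lekn : (k <= n)%N by rewrite -ltnS.
have pochE q : pochhammer q n = pochhammer q k * pochhammer (q + k%:R) (n - k).
  by rewrite -pochhammerD subnKC.
rewrite /gegen_coef lekn !pochE exprMn.
have hck i : c + k%:R <> - i%:R.
  by move=> e; apply: (hc (i + k)%N); rewrite natrD opprD -e addrK.
have hS := saalschutz (a + k%:R) (n - k) hck.
have e2b : a + k%:R + (c + k%:R) - 1 = 2%:R * b + 2%:R * k%:R.
  by rewrite /b; field.
rewrite e2b in hS.
transitivity (pochhammer a k / pochhammer c k * binser b k * ((- 4%:R) ^+ k * t ^+ k)
   * (pochhammer (a + k%:R) (n - k) / pochhammer (c + k%:R) (n - k) *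
     binser (2%:R * b + 2%:R * k%:R) (n - k))); last first.
  rewrite invfM; ring.
rewrite -hS mulr_sumr; apply: eq_bigr => m _.
rewrite /saal_term e2b (addnC m) !pochhammerD exprD.
have -> : (2%:R * b + 2%:R * k%:R) / 2%:R = b + k%:R by field.
have -> : (c + k%:R - (a + k%:R)) / 2%:R = (c - a) / 2%:R by congr (_ / _); ring.
have -> : 2%:R * b + 2%:R * (k + m)%:R = 2%:R * b + 2%:R * k%:R + 2%:R * m%:R.
  by rewrite natrD; ring.
rewrite [binser b k]/binser !invfM; ring.
Qed.

End Algebra.

(** * Unconditional sums *)

Section HasSum.
Variable K : numFieldType.

Definition has_sum (I : choiceType) (f : I -> K) (S : K) :=
  forall e, 0 < e -> exists A0 : {fset I},
    forall A : {fset I}, (A0 `<=` A)%fset -> `|\sum_(i <- A) f i - S| < e.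

Lemma has_sum_unique (I : choiceType) (f : I -> K) S T :
  has_sum f S -> has_sum f T -> S = T.
Proof.
move=> hS hT; apply/eqP; rewrite -subr_eq0 -normr_eq0; apply/negPn/negP => neq0.
have lt0 : 0 < `|S - T| / 2%:R by rewrite divr_gt0 // lt_neqAle eq_sym neq0 normr_ge0.
have [A hA] := hS _ lt0; have [B hB] := hT _ lt0.
have := ltrD (hA _ (fsubsetUl A B)) (hB _ (fsubsetUr A B)).
rewrite -mulr2n -[_ *+ 2]mulr_natr divfK ?pnatr_eq0 //.
rewrite (distrC _ S) => /(le_lt_trans (ler_normD _ _)).
by rewrite addrA subrK ltxx.
Qed.

Lemma eq_has_sum (I : choiceType) (f g : I -> K) S :
  f =1 g -> has_sum f S -> has_sum g S.
Proof.
move=> fg hf e e0; have [A hA] := hf e e0; exists A => B /hA.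
by rewrite (eq_bigr _ (fun i _ => fg i)).
Qed.

Lemma has_sumZ (I : choiceType) (f : I -> K) c S :
  has_sum f S -> has_sum (fun i => c * f i) (c * S).
Proof.
move=> hf e e0; have [->|c0] := eqVneq c 0.
  exists fset0 => B _; rewrite big1 => [|i _]; last by rewrite mul0r.
  by rewrite mul0r subrr normr0.
have c'0 : 0 < `|c| by rewrite normr_gt0.
have [A hA] := hf (e / `|c|) (divr_gt0 e0 c'0).
exists A => B /hA; rewrite ltr_pdivlMr // => hB.
by rewrite -mulr_sumr -mulrBr normrM mulrC.
Qed.

Lemma has_sumD (I : choiceType) (f g : I -> K) S T :
  has_sum f S -> has_sum g T -> has_sum (fun i => f i + g i) (S + T).
Proof.
move=> hf hg e e0; have e2 : 0 < e / 2%:R by rewrite divr_gt0.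
have [A hA] := hf _ e2; have [B hB] := hg _ e2.
exists (A `|` B)%fset => C; rewrite fsubUset => /andP[/hA hAC /hB hBC].
rewrite big_split /= opprD addrACA (le_lt_trans (ler_normD _ _)) //.
by rewrite [e]splitr ltrD.
Qed.

(** Summing over an index set or over a larger one on which the family is
    extended by 0 is the same; the partial inverse psi makes the preimage of a
    finite set explicit. *)
Lemma has_sum_emb (I J : choiceType) (phi : J -> I) (psi : I -> J) (f : I -> K) S :
  cancel phi psi -> (forall i, phi (psi i) != i -> f i = 0) ->
  has_sum (f \o phi) S -> has_sum f S.
Proof.
move=> phiK f0 hf e /hf[A hA]; exists [fset phi j | j in A]%fset => B AB.
pose D := [fset i in B | phi (psi i) == i]%fset.
pose C := [fset psi i | i in D]%fset.
have /hA : (A `<=` C)%fset.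
  apply/fsubsetP => j jA; apply/imfsetP; exists (phi j); last by rewrite phiK.
  by rewrite !inE phiK eqxx andbT (fsubsetP AB) // in_imfset.
have -> : \sum_(i <- B) f i = \sum_(i <- D) f i.
  rewrite -big_fset_condE [LHS](bigID (fun i => phi (psi i) == i)) /=.
  by rewrite [X in _ + X]big1 ?addr0 // => i /f0.
congr (`|_ - S| < e); rewrite big_imfset /=.
  by apply: eq_big_seq => i; rewrite !inE => /andP[_ /eqP ->].
by move=> i k; rewrite !inE => /andP[_ /eqP ei] /andP[_ /eqP ek] eik;
   rewrite -ei -ek eik.
Qed.

Lemma has_sum_shift (f : nat -> K) S :
  f 0%N = 0 -> has_sum (fun n => f n.+1) S -> has_sum f S.
Proof.
by move=> f0; apply: (has_sum_emb (psi := predn)) => // -[|n]; rewrite ?f0 ?eqxx.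
Qed.

(** Given a large finite set B of fibers, approximate the sum over each fiber
    in B up to e / (2 (|B| + 1)) on one common finite set V; the part of V
    above B then contains the finite set that approximates the total sum. *)
Lemma has_sum_partition (I J : choiceType) (g : I -> J) (f : I -> K) h S :
  has_sum f S ->
  (forall j, has_sum (fun i => if g i == j then f i else 0) (h j)) ->
  has_sum h S.
Proof.
move=> hf hh e e0; have e2 : 0 < e / 2%:R by rewrite divr_gt0.
have [A hA] := hf _ e2; exists [fset g i | i in A]%fset => B AB.
have e' : 0 < e / 2%:R / (#|` B|.+1)%:R by rewrite divr_gt0 // ltr0n.
have /choice[F hF] := fun j => hh j _ e'.
pose V := (A `|` \bigcup_(j <- B) F j)%fset.
pose U := [fset i in V | g i \in B]%fset.
have AU : (A `<=` U)%fset.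
  apply/fsubsetP => i iA; rewrite !inE iA /= (fsubsetP AB) //.
  by rewrite in_imfset.
have eU : \sum_(i <- U) f i =
    \sum_(j <- B) \sum_(i <- V) (if g i == j then f i else 0).
  rewrite exchange_big /= /U -big_fset_condE /= big_mkcond; apply: eq_bigr => i _.
  rewrite -big_mkcond /=; case: ifPn => giB.
    rewrite -big_filter (eq_filter (a2 := pred1 (g i))) => [|j]; last first.
      by rewrite /= eq_sym.
    by rewrite filter_pred1_uniq ?fset_uniq // big_seq1.
  rewrite big_seq_cond big1 // => j /andP[jB /eqP gij].
  by rewrite gij jB in giB.
have -> : \sum_(j <- B) h j - S =
    \sum_(j <- B) (h j - \sum_(i <- V) (if g i == j then f i else 0))
    + (\sum_(i <- U) f i - S).
  by rewrite sumrB eU addrA subrK.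
rewrite (le_lt_trans (ler_normD _ _)) // [e]splitr ler_ltD ?hA //.
rewrite (le_trans (ler_norm_sum _ _ _)) //.
apply: (@le_trans _ _ (\sum_(j <- B) (e / 2%:R / (#|` B|.+1)%:R))).
  rewrite big_seq [leRHS]big_seq; apply: ler_sum => j jB.
  rewrite distrC ltW // hF // /V fsubsetU //; apply/orP; right.
  exact: bigfcup_sup.
rewrite big_const_seq count_predT iter_addr_0 -[leLHS]mulr_natr.
rewrite -mulrA ger_pMr // mulrC ler_pdivrMr ?ltr0n // mul1r ler_nat.
by rewrite leqW // -[size _]/(#|` B|).
Qed.

Lemma has_sum_fin (I : choiceType) (f : I -> K) (A : {fset I}) :
  (forall i, i \notin A -> f i = 0) -> has_sum f (\sum_(i <- A) f i).
Proof.
move=> f0 e e0; exists A => B AB.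
by rewrite -(big_fset_incl _ AB) ?subrr ?normr0 // => i _ /f0.
Qed.

(** The case of finite fibers: phi j enumerates the fiber of g above j, which
    has N j elements. *)
Lemma has_sum_fibers (I J : choiceType) (g : I -> J) (N : J -> nat)
    (phi : J -> nat -> I) (f : I -> K) S :
  (forall j n, (n < N j)%N -> g (phi j n) = j) ->
  (forall j n m, (n < N j)%N -> (m < N j)%N -> phi j n = phi j m -> n = m) ->
  (forall i, exists2 n, (n < N (g i))%N & phi (g i) n = i) ->
  has_sum f S -> has_sum (fun j => \sum_(n < N j) f (phi j n)) S.
Proof.
move=> gphi phi_inj phi_surj hf; apply: (has_sum_partition (g := g) hf) => j.
pose A := [fset phi j (val n) | n in 'I_(N j)]%fset.
have -> : \sum_(n < N j) f (phi j n) =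
    \sum_(i <- A) (if g i == j then f i else 0).
  rewrite big_imfset /= => [|n m _ _ /phi_inj nm]; last first.
    by apply: val_inj; apply: nm; apply: ltn_ord.
  by rewrite big_enum /=; apply: eq_bigr => n _; rewrite gphi // eqxx.
apply: has_sum_fin => i iA; case: eqP => // gij; move: iA.
have [n] := phi_surj i; rewrite gij => nN <-.
by case/negP; apply/imfsetP; exists (Ordinal nN).
Qed.

End HasSum.

(** * Existence of unconditional sums *)

Section Existence.
Variable R : realType.

Definition bounded_sums (I : choiceType) (g : I -> R) M :=
  forall A : {fset I}, \sum_(i <- A) g i <= M.

Lemma le_sum_fset (I : choiceType) (g : I -> R) (A B : {fset I}) :
  (forall i, 0 <= g i) -> (A `<=` B)%fset ->
  \sum_(i <- A) g i <= \sum_(i <- B) g i.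
Proof.
move=> g0 AB; rewrite [leRHS](bigID (fun i => i \in A)) /=.
rewrite [X in X + _]big_fset_condE /=.
have -> : [fset i in B | i \in A]%fset = A.
  by apply/fsetP => i; rewrite !inE andbC; case: (boolP (i \in A)) => // /(fsubsetP AB).
by rewrite lerDl sumr_ge0.
Qed.

Lemma has_sum_ge0 (I : choiceType) (g : I -> R) M :
  (forall i, 0 <= g i) -> bounded_sums g M -> exists S, has_sum g S.
Proof.
move=> g0 gM; pose E := [set \sum_(i <- A) g i | A in @setT {fset I}]%classic.
have supE : has_sup E.
  split; first by exists (\sum_(i <- fset0) g i); exists fset0.
  by exists M => _ [A _ <-].
exists (sup E) => e e0.
have [_ [A _ <-] ltA] := sup_adherent e0 supE.
exists A => B /(le_sum_fset g0) leAB.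
have leB : \sum_(i <- B) g i <= sup E.
  by apply: sup_upper_bound => //; exists B.
rewrite distrC ger0_norm ?subr_ge0 // ltrBlDr -ltrBlDl.
exact: lt_le_trans leAB.
Qed.

(** A dominated family is the difference of the nonnegative families g + f
    and g. *)
Lemma has_sum_real (I : choiceType) (f g : I -> R) M :
  (forall i, `|f i| <= g i) -> bounded_sums g M -> exists S, has_sum f S.
Proof.
move=> fg gM.
have g0 i : 0 <= g i by exact: le_trans (fg i).
have [S hS] := has_sum_ge0 g0 gM.
have fg0 i : 0 <= g i + f i.
  by have := fg i; rewrite ler_norml addrC -lerBlDr sub0r => /andP[].
have fgM : bounded_sums (fun i => g i + f i) (M + M).
  move=> A; rewrite big_split lerD ?gM //.
  by apply: le_trans (gM A); apply: ler_sum => i _; exact: le_trans (ler_norm _) (fg i).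
have [T hT] := has_sum_ge0 fg0 fgM.
exists (T + (-1) * S).
by apply: eq_has_sum (has_sumD hT (has_sumZ (-1) hS)) => i; ring.
Qed.

Lemma ReB (x y : R[i]) : complex.Re (x - y) = complex.Re x - complex.Re y.
Proof. by case: x; case: y. Qed.

Lemma ImB (x y : R[i]) : complex.Im (x - y) = complex.Im x - complex.Im y.
Proof. by case: x; case: y. Qed.

Lemma Re_sum (I : Type) (r : seq I) (f : I -> R[i]) :
  complex.Re (\sum_(i <- r) f i) = \sum_(i <- r) complex.Re (f i).
Proof. by apply: big_morph => // -[a b] [c d]. Qed.

Lemma Im_sum (I : Type) (r : seq I) (f : I -> R[i]) :
  complex.Im (\sum_(i <- r) f i) = \sum_(i <- r) complex.Im (f i).
Proof. by apply: big_morph => // -[a b] [c d]. Qed.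

Lemma has_sum_ReIm (I : choiceType) (f : I -> R[i]) (a b : R) :
  has_sum (fun i => complex.Re (f i)) a -> has_sum (fun i => complex.Im (f i)) b ->
  has_sum f (a +i* b).
Proof.
move=> ha hb e e0.
have [r r0 ->] : exists2 r : R, 0 < r & e = r%:C.
  exists (complex.Re e); first by move: e0; rewrite ltcE => /andP[].
  by rewrite RRe_real // gtr0_real.
have r2 : 0 < r / 2 by rewrite divr_gt0.
have [A hA] := ha _ r2; have [B hB] := hb _ r2.
exists (A `|` B)%fset => C; rewrite fsubUset => /andP[/hA hAC /hB hBC].
have -> : \sum_(i <- C) f i - (a +i* b) =
   (\sum_(i <- C) complex.Re (f i) - a)%:C + 'i * (\sum_(i <- C) complex.Im (f i) - b)%:C.
  by rewrite [LHS]complexE ReB ImB Re_sum Im_sum.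
rewrite (le_lt_trans (ler_normD _ _)) // normrM.
have -> : `|'i : R[i]| = 1.
  by rewrite normc_def /= expr0n expr1n add0r sqrtr1.
have normC (x : R) : `|x%:C| = `|x|%:C.
  by rewrite normc_def /= expr0n addr0 sqrtr_sqr.
by rewrite mul1r !normC -rmorphD ltcR [r]splitr ltrD.
Qed.

Lemma le_Re_normc (z : R[i]) (x : R) : `|z| <= x%:C -> `|complex.Re z| <= x.
Proof.
rewrite normc_def lecR; apply: le_trans.
by rewrite -sqrtr_sqr ler_wsqrtr // lerDl sqr_ge0.
Qed.

Lemma le_Im_normc (z : R[i]) (x : R) : `|z| <= x%:C -> `|complex.Im z| <= x.
Proof.
rewrite normc_def lecR; apply: le_trans.
by rewrite -sqrtr_sqr ler_wsqrtr // lerDr sqr_ge0.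
Qed.

Lemma has_sum_dominated (I : choiceType) (f : I -> R[i]) (g : I -> R) M :
  (forall i, `|f i| <= (g i)%:C) -> bounded_sums g M -> exists S, has_sum f S.
Proof.
move=> fg gM.
have [a ha] := has_sum_real (fun i => le_Re_normc (fg i)) gM.
have [b hb] := has_sum_real (fun i => le_Im_normc (fg i)) gM.
by exists (a +i* b); apply: has_sum_ReIm.
Qed.

(** Links the definition by finite sets to the limit along the filter of
    finite sets that defines Appell's function. *)
Lemma has_sum_sumE (I : choiceType) (f : I -> R[i]) S :
  has_sum f S -> summability.sum (f : I -> R[i]^o) = S.
Proof.
have ? : ProperFilter (@summability.totally I) by exact: summability.totally_filter.
move=> hf; apply: cvg_lim; first exact: norm_hausdorff.
apply/(@cvgrPdist_lt _ (R[i]^o)) => e e0; have [A hA] := hf e e0.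
exists A => // B /= /hA; rewrite distrC /summability.partial_sum.
by rewrite big_seq_fsetE.
Qed.

Lemma fset_nat_bound (A : {fset nat}) : exists N, forall i, i \in A -> (i < N)%N.
Proof.
exists (\max_(i <- A) i).+1 => i iA; rewrite ltnS.
by rewrite (big_fsetD1 i) //= leq_maxl.
Qed.

Lemma sum_fset_iota (f : nat -> R) n :
  \sum_(i <- [fset i in iota 0 n]%fset) f i = \sum_(0 <= i < n) f i.
Proof.
apply: perm_big; apply: uniq_perm; rewrite ?fset_uniq ?iota_uniq // => i.
by rewrite inE /= /index_iota subn0.
Qed.

Lemma has_sum_series (f : nat -> R) S :
  has_sum f S -> (series f n @[n --> \oo] --> S)%classic.
Proof.
move=> hf; apply/cvgrPdist_lt => e e0; have [A hA] := hf e e0.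
have [N hN] := fset_nat_bound A.
exists N => // n /= leNn.
pose B := [fset i in iota 0 n]%fset.
have /hA : (A `<=` B)%fset.
  by apply/fsubsetP => i /hN ltiN; rewrite inE /= mem_iota (leq_trans ltiN).
by rewrite distrC sum_fset_iota.
Qed.

Lemma bounded_sums_geom (M : R) : 0 <= M ->
  bounded_sums (fun n : nat => M * 2%:R^-1 ^+ n) (M * 2%:R).
Proof.
move=> M0 A; rewrite -mulr_sumr ler_wpM2l //.
have [N hN] := fset_nat_bound A.
pose B := [fset i in iota 0 N]%fset.
have AB : (A `<=` B)%fset.
  by apply/fsubsetP => i /hN ltiN; rewrite inE /= mem_iota.
apply: le_trans (le_sum_fset _ AB) _; first by move=> i; rewrite exprn_ge0.
rewrite sum_fset_iota.
suff -> : \sum_(0 <= i < N) (2%:R^-1 : R) ^+ i = 2%:R - 2%:R * 2%:R^-1 ^+ N.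
  by rewrite lerBlDr lerDl mulr_ge0 // exprn_ge0.
elim: N {hN B AB} => [|N IHN]; first by rewrite big_geq // expr0 mulr1 subrr.
by rewrite big_nat_recr //= IHN exprS; field.
Qed.

(** Fubini for nonnegative families, in the form of an inequality. *)
Lemma bounded_sums_prod (I J : choiceType) (f : I -> R) (g : J -> R) M N :
  (forall i, 0 <= f i) -> (forall j, 0 <= g j) -> 0 <= N ->
  bounded_sums f M -> bounded_sums g N ->
  bounded_sums (fun p : I * J => f p.1 * g p.2) (M * N).
Proof.
move=> f0 g0 N0 hf hg A.
rewrite (partition_big_imfset _ (fun p => p.1)) /=.
apply: (@le_trans _ _ (\sum_(i <- [fset p.1 | p in A]%fset) f i * N)).
  apply: ler_sum => i _.
  rewrite (eq_bigr (fun p => f i * g p.2)) => [|p /eqP -> //].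
  rewrite -mulr_sumr ler_wpM2l //.
  rewrite big_fset_condE.
  apply: le_trans (hg [fset p.2 | p in [fset p in A | p.1 == i]]%fset).
  rewrite [leRHS]big_imfset //= => -[p1 p2] [q1 q2]; rewrite !inE /=.
  by move=> /andP[_ /eqP ->] /andP[_ /eqP ->] ->.
by rewrite -mulr_suml ler_wpM2r.
Qed.

End Existence.

(** * The binomial series *)

Section Binomial.
Variable R : realType.

Lemma is_derive0_eq01 (f : R -> R) :
  (forall u : R, u \in `[0, 1] -> is_derive u (1 : R) f 0) -> f 1 = f 0.
Proof.
move=> df.
have df01 : {in `[(0 : R), 1], forall u : R, derivable f u 1}.
  by move=> u uI; have du := df u uI; exact: ex_derive.
have cf := derivable_within_continuous df01.
have df' (u : R) : u \in `]0, 1[ -> is_derive u (1 : R) f 0.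
  by move=> uI; apply: df; apply: subset_itv_oo_cc uI.
have [c _] := MVT_segment (df := fun=> 0) ler01 df' cf.
by rewrite mul0r => /eqP; rewrite subr_eq0 => /eqP.
Qed.

(** If W = P + i Q satisfies W' = - z' W with z = al + i th, then W exp(z) is
    constant; real and imaginary parts are differentiated separately. *)
Lemma exp_ode_const (P Q al th dP dQ dal dth : R -> R) :
  (forall u : R, u \in `[0, 1] -> is_derive u (1 : R) P (dP u)) ->
  (forall u : R, u \in `[0, 1] -> is_derive u (1 : R) Q (dQ u)) ->
  (forall u : R, u \in `[0, 1] -> is_derive u (1 : R) al (dal u)) ->
  (forall u : R, u \in `[0, 1] -> is_derive u (1 : R) th (dth u)) ->
  (forall u : R, u \in `[0, 1] ->
     dP u +i* dQ u = - (dal u +i* dth u) * (P u +i* Q u)) ->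
  (P 1 +i* Q 1) * cexp (al 1 +i* th 1) = (P 0 +i* Q 0) * cexp (al 0 +i* th 0).
Proof.
move=> hP hQ hal hth hode.
pose f u := expR (al u) * (P u * cos (th u) - Q u * sin (th u)).
pose g u := expR (al u) * (P u * sin (th u) + Q u * cos (th u)).
have fg u : (P u +i* Q u) * cexp (al u +i* th u) = f u +i* g u.
  by rewrite /cexp /f /g /=; apply/eqP; rewrite eq_complex /=; apply/andP; split;
    apply/eqP; ring.
rewrite !fg; congr (_ +i* _); apply: is_derive0_eq01 => u uI.
  have := hP _ uI; have := hQ _ uI; have := hal _ uI; have := hth _ uI.
  move=> h1 h2 h3 h4; rewrite /f; apply: is_derive_eq.
  have [eP eQ] : dP u = - dal u * P u + dth u * Q u /\ dQ u = - dal u * Q u - dth u * P u.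
    by case: (hode _ uI) => -> ->; split; ring.
  rewrite eP eQ /GRing.scale /=; ring.
have := hP _ uI; have := hQ _ uI; have := hal _ uI; have := hth _ uI.
move=> h1 h2 h3 h4; rewrite /g; apply: is_derive_eq.
have [eP eQ] : dP u = - dal u * P u + dth u * Q u /\ dQ u = - dal u * Q u - dth u * P u.
  by case: (hode _ uI) => -> ->; split; ring.
rewrite eP eQ /GRing.scale /=; ring.
Qed.

(** Along the ray u |-> u x, the derivative of log (1 - u x) is
    - x / (1 - u x). *)
Lemma is_derive_clog_ray (x : R[i]) (u : R) : 0 < complex.Re (1 - u%:C * x) ->
  is_derive u (1 : R) (fun u => complex.Re (clog (1 - u%:C * x)))
    (complex.Re (- x / (1 - u%:C * x))) /\
  is_derive u (1 : R) (fun u => complex.Im (clog (1 - u%:C * x)))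
    (complex.Im (- x / (1 - u%:C * x))).
Proof.
case: x => x1 x2.
have e v : 1 - v%:C * (x1 +i* x2) = (1 - v * x1) +i* (- (v * x2)).
  by apply/eqP; rewrite eq_complex /=; apply/andP; split; apply/eqP; ring.
rewrite (e u) => re0; have {}re0 : 0 < 1 - u * x1 by [].
pose N (v : R) := (1 - v * x1) ^+ 2 + (- (v * x2)) ^+ 2.
have N0 : 0 < N u by rewrite ltr_pwDl ?sqr_ge0 // exprn_gt0.
have ReImV a b : (a +i* b) / ((1 - u * x1) +i* (- (u * x2))) =
    ((a * (1 - u * x1) - b * (u * x2)) / N u) +i* ((b * (1 - u * x1) + a * (u * x2)) / N u).
  rewrite /N; apply/eqP; rewrite eq_complex /=; apply/andP; split; apply/eqP; ring.
rewrite -[- (x1 +i* x2)]/((- x1) +i* (- x2)) (ReImV (- x1) (- x2)) /=; split.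
  have -> : (fun v : R => complex.Re (clog (1 - v%:C * (x1 +i* x2)))) =
     @ln R \o (Num.sqrt \o N).
    by apply/funext => v; rewrite e.
  have d1 : is_derive u (1 : R) N (2%:R * (- x1 * (1 - u * x1) + u * x2 ^+ 2)).
    by apply: is_derive_eq; rewrite /GRing.scale /=; ring.
  have d2 := is_derive1_comp (g := N) (is_derive1_sqrt N0) d1.
  have s0 : 0 < Num.sqrt (N u) by rewrite sqrtr_gt0.
  have d3 := is_derive1_comp (g := Num.sqrt \o N) (is_derive1_ln s0) d2.
  apply: is_derive_eq d3 _.
  have hs := sqr_sqrtr (ltW N0); rewrite -[N u in RHS]hs /=.
  field; exact: lt0r_neq0.
have -> : (fun v : R => complex.Im (clog (1 - v%:C * (x1 +i* x2)))) =
    @atan R \o (fun v => - (v * x2) * (1 - v * x1)^-1).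
  by apply/funext => v; rewrite e.
have ne0 : 1 - u * x1 != 0 by exact: lt0r_neq0.
have d0 : is_derive u (1 : R) (fun v => 1 - v * x1) (- x1).
  by apply: is_derive_eq; rewrite /GRing.scale /=; ring.
have d1 := @is_deriveV R (fun v => 1 - v * x1) u _ 1 ne0 d0.
have d2 : is_derive u (1 : R) (fun v => - (v * x2) * (1 - v * x1)^-1)
    (- x2 / (1 - u * x1) ^+ 2).
  by apply: is_derive_eq; rewrite /GRing.scale /=; field.
have d3 := is_derive1_comp (is_derive1_atan _) d2.
apply: is_derive_eq d3 _.
move: N0; rewrite /N => /lt0r_neq0 N0.
by field; rewrite ?ne0 N0.
Qed.

Lemma is_derive_Mclog_ray (q x : R[i]) (u : R) : 0 < complex.Re (1 - u%:C * x) ->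
  is_derive u (1 : R) (fun u => complex.Re (q * clog (1 - u%:C * x)))
    (complex.Re (q * (- x / (1 - u%:C * x)))) /\
  is_derive u (1 : R) (fun u => complex.Im (q * clog (1 - u%:C * x)))
    (complex.Im (q * (- x / (1 - u%:C * x)))).
Proof.
move=> /is_derive_clog_ray[]; case: q => q1 q2.
have ReM (z : R[i]) : complex.Re ((q1 +i* q2) * z) = q1 * complex.Re z - q2 * complex.Im z.
  by case: z.
have ImM (z : R[i]) : complex.Im ((q1 +i* q2) * z) = q1 * complex.Im z + q2 * complex.Re z.
  by case: z.
rewrite ReM ImM.
set f := (fun u : R => complex.Re _); set g := (fun u : R => complex.Im _) => df dg.
split.
  have -> : (fun v : R => complex.Re ((q1 +i* q2) * clog (1 - v%:C * x))) =
     (fun v => q1 * f v - q2 * g v) by apply/funext => v; rewrite ReM.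
  by apply: is_derive_eq; rewrite /GRing.scale /=; ring.
have -> : (fun v : R => complex.Im ((q1 +i* q2) * clog (1 - v%:C * x))) =
   (fun v => q1 * g v + q2 * f v) by apply/funext => v; rewrite ImM.
by apply: is_derive_eq; rewrite /GRing.scale /=; ring.
Qed.

Lemma has_sum_lim (f : nat -> R) M :
  (forall n, `|f n| <= M * (2%:R^-1) ^+ n) ->
  has_sum f (limn (series f)) /\ cvgn (series f).
Proof.
move=> fM; have M0 : 0 <= M.
  by apply: le_trans (normr_ge0 _) (le_trans (fM 0%N) _); rewrite expr0 mulr1.
have [S hS] := has_sum_real fM (bounded_sums_geom M0).
have cS := has_sum_series hS.
split; last by apply/cvg_ex; exists S.
suff -> : limn (series f) = S by [].
exact: cvg_lim.
Qed.

(** Differentiating a power series costs a factor n + 1 <= 2^n, hence at most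
    halves the radius given by a geometric bound. *)
Lemma pseries_diffs_bound (c : nat -> R) M rho : 0 <= rho <= 1 ->
  (forall n, `|c n| <= M * rho ^+ n) ->
  forall n, `|pseries_diffs c n| <= M * (2%:R * rho) ^+ n.
Proof.
move=> /andP[rho0 rho1] cM n; have M0 : 0 <= M.
  by apply: le_trans (normr_ge0 _) (le_trans (cM 0%N) _); rewrite expr0 mulr1.
rewrite /pseries_diffs normrM normr_nat exprMn.
apply: (@le_trans _ _ (2%:R ^+ n * (M * rho ^+ n))); last by rewrite mulrCA.
apply: ler_pM => //; first by rewrite -natrX ler_nat ltn_expl.
apply: le_trans (cM _) _; rewrite ler_wpM2l // exprS ler_piMl ?exprn_ge0 //.
Qed.

Lemma pseries_bound (c : nat -> R) M rho u :
  `|u| <= 2%:R -> 2%:R * rho <= 2%:R^-1 -> 0 <= rho ->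
  (forall n, `|c n| <= M * rho ^+ n) ->
  forall n, `|c n * u ^+ n| <= M * 2%:R^-1 ^+ n.
Proof.
move=> u2 rho2 rho0 cM n; have M0 : 0 <= M.
  by apply: le_trans (normr_ge0 _) (le_trans (cM 0%N) _); rewrite expr0 mulr1.
rewrite normrM normrX.
apply: (@le_trans _ _ (M * rho ^+ n * 2%:R ^+ n)).
  by apply: ler_pM => //; rewrite ?mulr_ge0 ?exprn_ge0 // lerXn2r ?nnegrE.
rewrite -mulrA -exprMn ler_wpM2l // lerXn2r ?nnegrE ?mulr_ge0 //.
by rewrite mulrC.
Qed.

(** Term by term differentiation asks for the convergence at the point 2 of the
    series and of its first two derived series. Each derivation replaces the
    ratio 1/16 by its double, and evaluating at 2 doubles once more: the ratios
    are 1/8, 1/4 and 1/2. *)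
Lemma pseries_geom (c : nat -> R) M : (forall n, `|c n| <= M * 16%:R^-1 ^+ n) ->
  forall u, `|u| <= 1 ->
  [/\ is_derive u (1 : R) (fun u => limn (pseries c u)) (limn (pseries (pseries_diffs c) u)),
      has_sum (fun n => c n * u ^+ n) (limn (pseries c u)) &
      has_sum (fun n => pseries_diffs c n * u ^+ n) (limn (pseries (pseries_diffs c) u))].
Proof.
move=> c0 u u1.
have c1 := pseries_diffs_bound _ c0.
have {}c1 : forall n, `|pseries_diffs c n| <= M * 8%:R^-1 ^+ n.
  have e8 : 8%:R^-1 = 2%:R * 16%:R^-1 :> R by field.
  rewrite e8; apply: c1; apply/andP; split; lra.
have c2 := pseries_diffs_bound _ c1.
have {}c2 : forall n, `|pseries_diffs (pseries_diffs c) n| <= M * 4%:R^-1 ^+ n.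
  have e4 : 4%:R^-1 = 2%:R * 8%:R^-1 :> R by field.
  rewrite e4; apply: c2; apply/andP; split; lra.
have n2 : `|2%:R : R| <= 2%:R by rewrite normr_nat.
have u2 : `|u| <= 2%:R by lra.
have h (d : nat -> R) rho v : 0 <= rho -> 2%:R * rho <= 2%:R^-1 ->
    (forall n, `|d n| <= M * rho ^+ n) -> `|v| <= 2%:R ->
    has_sum (fun n => d n * v ^+ n) (limn (pseries d v)) /\ cvgn (pseries d v).
  by move=> rho0 rho2 dM v2; apply: has_sum_lim (pseries_bound v2 rho2 rho0 dM).
have h0 v := h _ _ v _ _ c0; have h1 v := h _ _ v _ _ c1; have h2 v := h _ _ v _ _ c2.
split.
- apply: (@pseries_snd_diffs _ _ 2%:R).
  + by apply: (h0 _ _ _ _).2 => //; lra.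
  + by apply: (h1 _ _ _ _).2 => //; lra.
  + by apply: (h2 _ _ _ _).2 => //; lra.
  + by rewrite normr_nat; apply: le_lt_trans u1 _; rewrite ltr1n.
- by apply: (h0 _ _ _ _).1 => //; lra.
- by apply: (h1 _ _ _ _).1 => //; lra.
Qed.

(** Compares with the binomial coefficient of r + l over l. The bound is
    geometric in l with a ratio independent of q, so that one disc of
    convergence serves all exponents at once. *)
Lemma norm_binser_le (q : R[i]) (r l : nat) : `|q| <= r%:R ->
  `|binser q l| <= 2%:R ^+ (r + l).
Proof.
move=> qr; apply: (@le_trans _ _ 'C(r + l, l)%:R).
  elim: l => [|l IHl]; first by rewrite binser0 normr1 bin0.
  rewrite binserS normrM (normrM (binser q l)) (normfV l.+1%:R) normr_nat.
  rewrite ler_pdivrMr ?ltr0n //.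
  rewrite -natrM mulnC addnS -mul_bin_diag natrM mulrC /=.
  apply: ler_pM => //; apply: le_trans (ler_normD _ _) _.
  rewrite normr_nat; apply: le_trans (lerD qr (lexx _)) _.
  by rewrite -natrD ler_nat.
rewrite -natrX ler_nat.
have := @expnDn 1 1 (r + l); rewrite add1n => ->.
rewrite (bigD1 (inord l)) //= inordK ?ltnS ?leq_addl // !exp1n !muln1.
exact: leq_addr.
Qed.

Lemma cexp0 : cexp (0 : R[i]) = 1.
Proof. by rewrite /cexp /= expR0 cos0 sin0 mul1r. Qed.

Lemma cexpD (z w : R[i]) : cexp (z + w) = cexp z * cexp w.
Proof.
case: z w => [z1 z2] [w1 w2]; rewrite /cexp /= expRD cosD sinD.
by apply/eqP; rewrite eq_complex /=; apply/andP; split; apply/eqP; ring.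
Qed.

Lemma cexpMN (z : R[i]) : cexp z * cexp (- z) = 1.
Proof. by rewrite -cexpD subrr cexp0. Qed.

Lemma clog1 : clog (1 : R[i]) = 0.
Proof.
by rewrite /clog /= expr1n expr0n addr0 sqrtr1 ln1 mul0r atan0.
Qed.

Lemma nat_norm_bound (z : R[i]) : exists r : nat, `|z| <= r%:R.
Proof.
have hr : 0 <= complex.Re `|z| by rewrite normc_def sqrtr_ge0.
exists (Num.truncn (complex.Re `|z|)).+1.
rewrite -[leLHS]RRe_real ?normr_real // -(rmorph_nat (real_complex R)) lecR.
by rewrite ltW // truncnS_gt.
Qed.

(** W(u), the sum of the series at u x, satisfies
    (1 - u x) W' = q x W on [0, 1], so W (1 - u x)^q is constant, equal to its
    value 1 at u = 0. *)
Lemma has_sum_cpow (q x : R[i]) : `|x| <= 32%:R^-1 ->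
  has_sum (fun l => binser q l * x ^+ l) (cpow (1 - x) (- q)).
Proof.
move=> x32.
have [r qr] := nat_norm_bound q.
pose w l := binser q l * x ^+ l.
(* 2 / 32 = 1 / 16 is the ratio that [pseries_geom] asks for. *)
pose M : R := 2%:R ^+ r.
have wM l : `|w l| <= (M * 16%:R^-1 ^+ l)%:C.
  rewrite normrM normrX rmorphM rmorphXn rmorphXn fmorphV !rmorph_nat.
  apply: (@le_trans _ _ (2%:R ^+ (r + l) * 32%:R^-1 ^+ l)).
    apply: ler_pM => //; rewrite ?exprn_ge0 //; first exact: norm_binser_le.
    by rewrite lerXn2r // nnegrE.
  by rewrite exprD -mulrA -exprMn (_ : 2%:R * 32%:R^-1 = 16%:R^-1) //; field.
have hc u u1 := @pseries_geom _ M (fun n => le_Re_normc (wM n)) u u1.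
have hd u u1 := @pseries_geom _ M (fun n => le_Im_normc (wM n)) u u1.
set c := (fun n => complex.Re (w n)) in hc.
set d := (fun n => complex.Im (w n)) in hd.
pose P u := limn (pseries c u); pose Q u := limn (pseries d u).
pose dP u := limn (pseries (pseries_diffs c) u).
pose dQ u := limn (pseries (pseries_diffs d) u).
have ReZ (z : R[i]) (v : R) : complex.Re (z * v%:C) = complex.Re z * v.
  by case: z => a b /=; ring.
have ImZ (z : R[i]) (v : R) : complex.Im (z * v%:C) = complex.Im z * v.
  by case: z => a b /=; ring.
have hW u : `|u| <= 1 -> has_sum (fun l => w l * u%:C ^+ l) (P u +i* Q u).
  move=> u1; have [_ hcu _] := hc u u1; have [_ hdu _] := hd u u1.
  apply: has_sum_ReIm.
    by apply: eq_has_sum hcu => l; rewrite -rmorphXn ReZ.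
  by apply: eq_has_sum hdu => l; rewrite -rmorphXn ImZ.
have hdW u : `|u| <= 1 ->
    has_sum (fun l => l.+1%:R * w l.+1 * u%:C ^+ l) (dP u +i* dQ u).
  have natC l : l.+1%:R = l.+1%:R%:C :> R[i] by rewrite rmorph_nat.
  move=> u1; have [_ _ hcu] := hc u u1; have [_ _ hdu] := hd u u1.
  apply: has_sum_ReIm.
    apply: eq_has_sum hcu => l.
    by rewrite -rmorphXn ReZ mulrC mulrC natC [_%:C * _]mulrC ReZ [_ * l.+1%:R]mulrC.
  apply: eq_has_sum hdu => l.
  by rewrite -rmorphXn ImZ mulrC mulrC natC [_%:C * _]mulrC ImZ [_ * l.+1%:R]mulrC.
have norm01 (u : R) : u \in `[0, 1] -> `|u| <= 1.
  by rewrite in_itv /= => /andP[u0 u1]; rewrite ger0_norm.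
have re0 (u : R) : u \in `[0, 1] -> 0 < complex.Re (1 - u%:C * x).
  move=> /norm01 u1.
  have : `|u%:C * x| <= (32%:R^-1)%:C.
    rewrite normrM fmorphV rmorph_nat -[leRHS]mul1r ler_pM //.
    by rewrite normc_def /= expr0n addr0 sqrtr_sqr lecR.
  move/le_Re_normc; rewrite ler_norml => /andP[_ h].
  rewrite ReB subr_gt0 (le_lt_trans h) //= invf_lt1 ?ltr1n //.
have ode (u : R) : u \in `[0, 1] -> dP u +i* dQ u =
    - (q * (- x / (1 - u%:C * x))) * (P u +i* Q u).
  move=> uI; have u1 := norm01 _ uI.
  have ne0 : 1 - u%:C * x != 0.
    by apply/eqP => e; have := re0 _ uI; rewrite e ltxx.
  (* The sum of l w_l u^l is u W'; with (l + 1) w_(l+1) = (q + l) x w_l this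
     gives the differential equation. *)
  have hlw : has_sum (fun l => l%:R * w l * u%:C ^+ l) (u%:C * (dP u +i* dQ u)).
    apply: has_sum_shift; first by rewrite !mul0r.
    by apply: eq_has_sum (has_sumZ u%:C (hdW u u1)) => l; rewrite exprS; ring.
  have h : has_sum (fun l => l.+1%:R * w l.+1 * u%:C ^+ l)
      (q * x * (P u +i* Q u) + x * (u%:C * (dP u +i* dQ u))).
    apply: eq_has_sum (has_sumD (has_sumZ (q * x) (hW u u1)) (has_sumZ x hlw)) => l.
    rewrite /w binserS exprS; field.
    by rewrite nat1r pnatr_eq0.
  have e := has_sum_unique (hdW u u1) h.
  apply: (mulfI ne0); rewrite mulrBl mul1r {1}e.
  by field.
have hmain := @exp_ode_const P Q
  (fun u : R => complex.Re (q * clog (1 - u%:C * x)))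
  (fun u : R => complex.Im (q * clog (1 - u%:C * x))) dP dQ
  (fun u : R => complex.Re (q * (- x / (1 - u%:C * x))))
  (fun u : R => complex.Im (q * (- x / (1 - u%:C * x)))).
have eta (z : R[i]) : complex.Re z +i* complex.Im z = z by case: z.
have : (P 1 +i* Q 1) * cexp (q * clog (1 - 1%:C * x)) =
    (P 0 +i* Q 0) * cexp (q * clog (1 - 0%:C * x)).
  rewrite -[q * clog (1 - 1%:C * x)]eta -[q * clog (1 - 0%:C * x)]eta.
  apply: hmain => u uI; have u1 := norm01 _ uI.
  - by case: (hc u u1).
  - by case: (hd u u1).
  - exact: (is_derive_Mclog_ray q (re0 u uI)).1.
  - exact: (is_derive_Mclog_ray q (re0 u uI)).2.
  - by rewrite eta ode.
rewrite mul0r subr0 clog1 mulr0 cexp0 mulr1 mul1r.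
have n0 : `|0 : R| <= 1 by rewrite normr0.
have n1 : `|1 : R| <= 1 by rewrite normr1.
have -> : P 0 +i* Q 0 = 1.
  apply: has_sum_unique (hW 0 n0) _.
  have := @has_sum_fin _ _ (fun l => w l * 0%:C ^+ l) [fset 0%N]%fset.
  rewrite big_seq_fset1 expr0 mulr1 /w binser0 expr0 mulr1; apply => -[|l].
    by rewrite inE eqxx.
  by rewrite expr0n /= mulr0.
move=> e; have := hW 1 n1.
have -> : P 1 +i* Q 1 = cpow (1 - x) (- q).
  rewrite /cpow mulNr -[LHS]mulr1.
  by rewrite -[X in _ * X = _](cexpMN (q * clog (1 - x))) mulrA e mul1r.
by apply: eq_has_sum => l; rewrite expr1n mulr1.
Qed.

End Binomial.

(** * Rearrangement of the Appell series *)

Section AppellSeries.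
Variable R : realType.
Implicit Types (a b c t s x q z : R[i]).

(** The ratios |b + i| / |c + i| are bounded: by 4 as soon as i is at least
    |b| + 2 |c|, and finitely many of them remain. *)
Lemma pochhammer_ratio_bound b c : (forall n, c <> - n%:R) ->
  exists D : nat, forall n, `|pochhammer b n / pochhammer c n| <= D%:R ^+ n.
Proof.
move=> hc; have hci i : c + i%:R != 0 by rewrite addr_eq0; apply/eqP.
suff [D hD] : exists D : nat, forall i, `|(b + i%:R) / (c + i%:R)| <= D%:R.
  exists D; elim=> [|n IHn]; first by rewrite !pochhammer0 divr1 normr1.
  by rewrite !pochhammerS -mulf_div normrM exprSr ler_pM.
have [rb hb] := nat_norm_bound b; have [rc hc'] := nat_norm_bound c.
have /choice[F hF] := fun i : nat => nat_norm_bound ((b + i%:R) / (c + i%:R)).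
exists (4 + \sum_(i < rb + 2 * rc) F i)%N => i.
have [lti|lei] := ltnP i (rb + 2 * rc).
  apply: le_trans (hF i) _; rewrite ler_nat (bigD1 (Ordinal lti)) //=.
  by rewrite addnCA leq_addr.
apply: (@le_trans _ _ 4%:R); last by rewrite ler_nat leq_addr.
rewrite normrM normfV ler_pdivrMr ?normr_gt0 //.
have h1 : `|b + i%:R| <= 2%:R * i%:R.
  apply: le_trans (ler_normD _ _) _; rewrite normr_nat.
  apply: le_trans (lerD hb (lexx _)) _.
  by rewrite -natrD -natrM ler_nat; lia.
apply: le_trans h1 _.
have h2 : i%:R <= `|c + i%:R| + rc%:R.
  have : `|i%:R : R[i]| <= `|c + i%:R| + `|- c|.
    by apply: le_trans _ (ler_normD _ _); rewrite addrC addKr.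
  by rewrite normrN normr_nat => /le_trans; apply; rewrite lerD2l.
have h3 : 2%:R * i%:R + 4%:R * rc%:R <= 4%:R * i%:R :> R[i].
  by rewrite -!natrM -natrD ler_nat; lia.
rewrite -(lerD2r (4%:R * rc%:R)); apply: le_trans h3 _.
by rewrite -mulrDr ler_wpM2l.
Qed.

Lemma bounded_sums_geom2 (M : R) : 0 <= M ->
  bounded_sums (fun p : nat * nat => M * 2%:R^-1 ^+ p.1 * (1 * 2%:R^-1 ^+ p.2))
    (M * 2%:R * (1 * 2%:R)).
Proof.
move=> M0; have h := bounded_sums_geom ler01.
apply: (bounded_sums_prod (f := fun n => M * 2%:R^-1 ^+ n) (g := fun n => 1 * 2%:R^-1 ^+ n)).
- by move=> i; rewrite ?mulr_ge0 ?exprn_ge0 ?invr_ge0.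
- by move=> i; rewrite ?mulr_ge0 ?exprn_ge0 ?invr_ge0.
- by rewrite mulr_ge0.
- exact: bounded_sums_geom.
- exact: h.
Qed.

Lemma has_sum_geom2 (f : nat * nat -> R[i]) (M : nat) :
  (forall p, `|f p| <= M%:R * 2%:R^-1 ^+ p.1 * 2%:R^-1 ^+ p.2) ->
  exists S, has_sum f S.
Proof.
move=> fM; apply: has_sum_dominated (bounded_sums_geom2 (ler0n _ M)) => p.
by apply: le_trans (fM p) _; rewrite mul1r !rmorphM !rmorphXn !fmorphV !rmorph_nat.
Qed.

Lemma has_sum_geom3 (f : nat * nat * nat -> R[i]) (M : nat) :
  (forall p, `|f p| <= M%:R * 2%:R^-1 ^+ p.1.1 * 2%:R^-1 ^+ p.1.2 * 2%:R^-1 ^+ p.2) ->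
  exists S, has_sum f S.
Proof.
move=> fM.
have h2 := bounded_sums_geom2 (ler0n R M); have h1 := bounded_sums_geom (@ler01 R).
have h : bounded_sums (fun p : nat * nat * nat =>
    M%:R * 2%:R^-1 ^+ p.1.1 * (1 * 2%:R^-1 ^+ p.1.2) * (1 * 2%:R^-1 ^+ p.2))
    (M%:R * 2%:R * (1 * 2%:R) * (1 * 2%:R) : R).
  apply: (bounded_sums_prod (g := fun n => 1 * 2%:R^-1 ^+ n) _ _ _ h2 h1).
  - by move=> i; rewrite ?mulr_ge0 ?exprn_ge0 ?invr_ge0.
  - by move=> i; rewrite ?mulr_ge0 ?exprn_ge0 ?invr_ge0.
  - by rewrite mulr_ge0.
apply: has_sum_dominated h => p.
by apply: le_trans (fM p) _; rewrite !mul1r !rmorphM !rmorphXn !fmorphV !rmorph_nat.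
Qed.

(** For q = - 1 the binomial series reduces to 1 - x. *)
Lemma cpow1 x : `|x| <= 32%:R^-1 -> cpow (1 - x) 1 = 1 - x.
Proof.
move=> hx; have := has_sum_cpow (-1) hx; rewrite opprK => h.
apply: (has_sum_unique h).
have := @has_sum_fin _ _ (fun l => binser (- 1) l * x ^+ l) [fset 0%N; 1%N]%fset.
rewrite big_fsetU1 ?inE //= big_seq_fset1 !binserS binser0 expr0 expr1.
have -> : 1 * 1 + 1 * (-1 + 0%:R) / 1%:R * x = 1 - x by field.
apply=> -[|[|l]]; rewrite ?inE // => _.
suff -> : binser (-1 : R[i]) l.+2 = 0 by rewrite mul0r.
by elim: l => [|l IHl]; rewrite binserS ?IHl ?mul0r // addNr mulr0 mul0r.
Qed.

Lemma cpow_neq0 z q : cpow z q != 0.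
Proof.
apply/eqP => e; have := cexpMN (q * clog z); rewrite -/(cpow z q) e mul0r.
by move/eqP; rewrite eq_sym oner_eq0.
Qed.

Lemma cpowD z q p : cpow z (q + p) = cpow z q * cpow z p.
Proof. by rewrite /cpow mulrDl cexpD. Qed.

Lemma cpow_shift x q n : `|x| <= 32%:R^-1 ->
  cpow (1 - x) (- (q + n%:R)) = cpow (1 - x) (- q) / (1 - x) ^+ n.
Proof.
move=> hx; elim: n => [|n IHn]; first by rewrite addr0 expr0 divr1.
have x0 : 1 - x != 0 by rewrite -cpow1 // cpow_neq0.
rewrite exprSr invfM mulrA -IHn.
have <- : cpow (1 - x) (- (q + n.+1%:R)) * cpow (1 - x) 1 = cpow (1 - x) (- (q + n%:R)).
  by rewrite -cpowD; congr cpow; rewrite -[n.+1%:R]natr1; ring.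
by rewrite cpow1 // mulfK.
Qed.

(** The terms of the right-hand side once the powers of 1 - x have been
    expanded: p = (m, k, l), where l is the index of the binomial series. *)
Definition triple_term a b c e t x (p : nat * nat * nat) : R[i] :=
  pochhammer b (p.1.1 + p.1.2) / pochhammer c (p.1.1 + p.1.2)
  * (pochhammer e p.1.1 * pochhammer a p.1.2 / (p.1.1`!%:R * p.1.2`!%:R))
  * (- 4%:R) ^+ (p.1.1 + p.1.2) * t ^+ p.1.2
  * binser (2%:R * b + 2%:R * (p.1.1 + p.1.2)%:R) p.2
  * x ^+ (p.1.1 + p.1.2 + p.2).

Lemma has_sum_triple_row a b c e t x : `|x| <= 32%:R^-1 -> forall m k,
  has_sum (fun l => triple_term a b c e t x (m, k, l))
   (cpow (1 - x) (- (2%:R * b)) *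
    appellF1_term b e a c (- (4%:R * x) / (1 - x) ^+ 2)
      (- (4%:R * x * t) / (1 - x) ^+ 2) (m, k)).
Proof.
move=> hx m k; have x0 : 1 - x != 0 by rewrite -cpow1 // cpow_neq0.
have h := has_sum_cpow (2%:R * b + 2%:R * (m + k)%:R) hx.
rewrite -(natrM _ 2) cpow_shift // in h.
rewrite /appellF1_term /triple_term /=.
set q := pochhammer b _ / _ * _.
have := has_sumZ (q * (- 4%:R) ^+ (m + k) * t ^+ k * x ^+ (m + k)) h.
have -> : q * (-4%:R) ^+ (m + k) * t ^+ k * x ^+ (m + k) *
     (cpow (1 - x) (- (2%:R * b)) / (1 - x) ^+ (2 * (m + k))) =
     cpow (1 - x) (- (2%:R * b)) *
      (q * (- (4%:R * x) / (1 - x) ^+ 2) ^+ m * (- (4%:R * x * t) / (1 - x) ^+ 2) ^+ k).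
  rewrite -!mulNr !exprMn !exprVn -!exprM mulnDr !exprD invfM; ring.
apply: eq_has_sum => l; rewrite [x ^+ (m + k + l)]exprD natrM; ring.
Qed.

(** |binser| <= 2^(r + l) and the bound on the ratio of rising factorials
    dominate the term by a constant times
    (32 D |x|)^m (32 D T |x|)^k (2 |x|)^l, with |t| <= T; the disc is chosen so
    that the three bases are at most 1/2. *)
Lemma has_sum_triple a b c e t : (forall n, c <> - n%:R) ->
  exists2 N : nat, (0 < N)%N & forall x, `|x| <= N%:R^-1 -> exists S,
    has_sum (triple_term a b c e t x) S.
Proof.
move=> hc.
have [D hD] := pochhammer_ratio_bound b hc.
have [T hT] := nat_norm_bound t.
have [ra hra] := nat_norm_bound a; have [re hre] := nat_norm_bound e.
have [rb hrb] := nat_norm_bound (2%:R * b).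
exists (64 * D.+1 * T.+1)%N => // x hx.
apply: (@has_sum_geom3 _ (2 ^ (ra + re + rb))) => -[[m k] l] /=.
rewrite /triple_term /=; set y := `|x| in hx.
have y0 : 0 <= y by rewrite normr_ge0.
have -> : pochhammer e m * pochhammer a k / (m`!%:R * k`!%:R) = binser e m * binser a k.
  by rewrite mulf_div.
rewrite !normrM !normrX normrN normr_nat -/y.
have hb : `|2%:R * b + 2%:R * (m + k)%:R| <= (rb + 2 * (m + k))%:R.
  apply: le_trans (ler_normD _ _) _.
  by rewrite -natrM normr_nat natrD lerD2r.
apply: (@le_trans _ _ (D%:R ^+ (m + k) * (2%:R ^+ (re + m) * 2%:R ^+ (ra + k)) *
    4%:R ^+ (m + k) * T%:R ^+ k * 2%:R ^+ (rb + 2 * (m + k) + l) * y ^+ (m + k + l))).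
  rewrite -normrM.
  do ! apply: ler_pM; rewrite ?mulr_ge0 ?exprn_ge0 ?normr_ge0 //.
  - by rewrite -normrM; apply: norm_binser_le.
  - by rewrite -normrM; apply: norm_binser_le.
  - by rewrite lerXn2r ?nnegrE.
  - by rewrite -normrM; apply: norm_binser_le.
have -> : D%:R ^+ (m + k) * (2%:R ^+ (re + m) * 2%:R ^+ (ra + k)) *
    4%:R ^+ (m + k) * T%:R ^+ k * 2%:R ^+ (rb + 2 * (m + k) + l) * y ^+ (m + k + l) =
    2%:R ^+ (ra + re + rb) * (32%:R * D%:R * y) ^+ m * (32%:R * D%:R * T%:R * y) ^+ k
      * (2%:R * y) ^+ l.
  have -> : 32%:R = 2%:R * 4%:R * 2%:R * 2%:R :> R[i] by ring.
  rewrite !exprMn mul2n -addnn !exprD; ring.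
have hyX (d n : nat) : (d * 2 <= 64 * D.+1 * T.+1)%N ->
    (d%:R * y) ^+ n <= 2%:R^-1 ^+ n.
  move=> hd; rewrite lerXn2r ?nnegrE ?mulr_ge0 //.
  apply: (@le_trans _ _ (d%:R * (64 * D.+1 * T.+1)%:R^-1)); first by rewrite ler_wpM2l.
  by rewrite ler_pdivrMr ?ltr0n // mulrC ler_pdivlMr ?ltr0n // -natrM ler_nat.
have hyX0 (d n : nat) : 0 <= (d%:R * y) ^+ n by rewrite exprn_ge0 // mulr_ge0.
rewrite natrX -!natrM.
do ! apply: ler_pM; rewrite ?mulr_ge0 ?exprn_ge0 ?hyX0 ?invr_ge0 ?mulr_ge0 ?normr_ge0 //.
- apply: hyX; nia.
- apply: hyX; nia.
- apply: hyX; nia.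
Qed.

(** The term is dominated by a constant times (2 D Y |x|)^j (2 D Z |x|)^k, with
    |y| <= Y and |z| <= Z. *)
Lemma has_sum_appellF1 a b1 b2 c y z : (forall n, c <> - n%:R) ->
  exists2 N : nat, (0 < N)%N & forall x, `|x| <= N%:R^-1 -> exists S,
    has_sum (appellF1_term a b1 b2 c (y * x) (z * x)) S.
Proof.
move=> hc.
have [D hD] := pochhammer_ratio_bound a hc.
have [r1 hr1] := nat_norm_bound b1; have [r2 hr2] := nat_norm_bound b2.
have [Y hY] := nat_norm_bound y; have [Z hZ] := nat_norm_bound z.
exists (4 * D.+1 * Y.+1 * Z.+1)%N => // x hx.
apply: (@has_sum_geom2 _ (2 ^ (r1 + r2))) => -[j k] /=.
rewrite /appellF1_term /=.
have -> : pochhammer b1 j * pochhammer b2 k / (j`!%:R * k`!%:R) = binser b1 j * binser b2 k.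
  by rewrite mulf_div.
rewrite normrM (normrM _ ((y * x) ^+ j)) (normrM (_ / _)) (normrM (binser _ _)).
rewrite !normrX !normrM.
rewrite -[X in X * _ * _ * _]normrM.
set u := `|x| in hx *.
have u0 : 0 <= u by rewrite normr_ge0.
apply: (@le_trans _ _ (D%:R ^+ (j + k) * (2%:R ^+ (r1 + j) * 2%:R ^+ (r2 + k)) *
    (Y%:R * u) ^+ j * (Z%:R * u) ^+ k)).
  do ! apply: ler_pM; rewrite ?mulr_ge0 ?exprn_ge0 ?mulr_ge0 ?normr_ge0 //.
  - by rewrite -normrM; apply: norm_binser_le.
  - by rewrite -normrM; apply: norm_binser_le.
  - by rewrite lerXn2r ?nnegrE ?mulr_ge0 // ler_wpM2r.
  - by rewrite lerXn2r ?nnegrE ?mulr_ge0 // ler_wpM2r.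
have -> : D%:R ^+ (j + k) * (2%:R ^+ (r1 + j) * 2%:R ^+ (r2 + k)) *
    (Y%:R * u) ^+ j * (Z%:R * u) ^+ k =
    2%:R ^+ (r1 + r2) * (2%:R * D%:R * Y%:R * u) ^+ j * (2%:R * D%:R * Z%:R * u) ^+ k.
  rewrite !exprMn !exprD; ring.
have hyX (q n : nat) : (q * 2 <= 4 * D.+1 * Y.+1 * Z.+1)%N ->
    (q%:R * u) ^+ n <= 2%:R^-1 ^+ n.
  move=> hq; rewrite lerXn2r ?nnegrE ?mulr_ge0 //.
  apply: (@le_trans _ _ (q%:R * (4 * D.+1 * Y.+1 * Z.+1)%:R^-1)); first by rewrite ler_wpM2l.
  by rewrite ler_pdivrMr ?ltr0n // mulrC ler_pdivlMr ?ltr0n // -natrM ler_nat.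
have hyX0 (d n : nat) : 0 <= (d%:R * u) ^+ n by rewrite exprn_ge0 // mulr_ge0.
rewrite natrX -!natrM.
do ! apply: ler_pM; rewrite ?mulr_ge0 ?exprn_ge0 ?hyX0 ?invr_ge0 ?mulr_ge0 ?normr_ge0 //.
- apply: hyX; nia.
- apply: hyX; nia.
Qed.

Lemma has_sum_diag (f : nat * nat -> R[i]) S :
  has_sum f S -> has_sum (fun n => \sum_(i < n.+1) f (i : nat, n - i)%N) S.
Proof.
apply: (has_sum_fibers (g := fun p => (p.1 + p.2)%N) (N := succn)
         (phi := fun n i => (i, n - i)%N)).
- by move=> n i; rewrite ltnS => /subnKC.
- by move=> n i j _ _ [].
- by case=> i j /=; exists i; rewrite ?ltnS ?leq_addr // addKn.
Qed.

(** Sorts the triples (m, k, l) first by (k, m + l), as Saalschutz's theorem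
    needs, then by k + m + l. *)
Lemma has_sum_triple_diag (f : nat * nat * nat -> R[i]) S : has_sum f S ->
  has_sum (fun n => \sum_(k < n.+1) \sum_(m < (n - k).+1) f (m : nat, k : nat, n - k - m)%N) S.
Proof.
move=> hf.
have h : has_sum (fun p : nat * nat => \sum_(m < p.2.+1) f (m : nat, p.1, p.2 - m)%N) S.
  apply: (has_sum_fibers (g := fun p => (p.1.2, p.1.1 + p.2)%N)
    (N := fun p => p.2.+1) (phi := fun p m => (m, p.1, p.2 - m)%N)) hf.
  - by move=> [k n] m /=; rewrite ltnS => /subnKC ->.
  - by move=> [k n] i j _ _ [].
  - by move=> [[m k] l] /=; exists m; rewrite ?ltnS ?leq_addr // addKn.
exact: (has_sum_diag h).
Qed.

Lemma triple_diagE a c t s x n : (forall n, c <> - n%:R) ->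
  s ^+ 2 = t * (t - 1) ->
  let b := (a + c - 1) / 2%:R in
  \sum_(k < n.+1) \sum_(m < (n - k).+1)
     triple_term a b c ((c - a) / 2%:R) t x (m : nat, k : nat, n - k - m)%N =
  \sum_(j < n.+1) appellF1_term a b b c ((1 - 2%:R * t + 2%:R * s) * x)
     ((1 - 2%:R * t - 2%:R * s) * x) (j : nat, n - j)%N.
Proof.
move=> hc hs b; transitivity (pochhammer a n / pochhammer c n *
   convolution (fun i => binser b i * (1 - 2%:R * t + 2%:R * s) ^+ i)
       (fun i => binser b i * (1 - 2%:R * t - 2%:R * s) ^+ i) n * x ^+ n).
  rewrite -(diagonal_coef_eq a n hc hs) mulr_suml; apply: eq_bigr => k _.
  rewrite mulr_suml; apply: eq_bigr => m _; rewrite /triple_term /=.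
  congr (_ * x ^+ _).
  have := leq_ord k; have := leq_ord m; lia.
rewrite /convolution mulr_sumr mulr_suml; apply: eq_bigr => j _.
rewrite /appellF1_term /= subnKC ?leq_ord // !exprMn.
rewrite /binser; set X := 1 - _ + _; set Y := 1 - _ - _.
have -> : x ^+ n = x ^+ j * x ^+ (n - j) by rewrite -exprD subnKC ?leq_ord.
by rewrite invfM; ring.
Qed.

End AppellSeries.

Local Open Scope classical_set_scope.

Theorem mainTheorem2 (R : realType) (a c t s : R[i])
    (hc : forall n : nat, c <> - n%:R)
    (hs : s ^+ 2 = t * (t - 1)) :
  let beta : R[i] := (a + c - 1) / 2%:R in
  let taup : R[i] := 1 - 2%:R * t + 2%:R * s in
  let taum : R[i] := 1 - 2%:R * t - 2%:R * s in
  \forall x \near (0 : R[i]^o),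
    appellF1 a beta beta c (taup * x) (taum * x) =
    cpow (1 - x) (- (2%:R * beta)) *
    appellF1 beta ((c - a) / 2%:R) a c
      (- (4%:R * x) / (1 - x) ^+ 2) (- (4%:R * x * t) / (1 - x) ^+ 2).
Proof.
move=> b taup taum; pose e := (c - a) / 2%:R.
have [N1 N10 hN1] := has_sum_appellF1 a b b taup taum hc.
have [N2 N20 hN2] := has_sum_triple a b e t hc.
have eps0 : 0 < (32 * N1 * N2)%:R^-1 :> R[i].
  by rewrite invr_gt0 ltr0n !muln_gt0 N10 N20.
have le_eps (N : nat) (x : R[i]) : (0 < N)%N -> (N <= 32 * N1 * N2)%N ->
    `|x| < (32 * N1 * N2)%:R^-1 -> `|x| <= N%:R^-1.
  move=> N0 leN /ltW/le_trans; apply.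
  by rewrite lef_pV2 ?posrE ?ltr0n ?ler_nat // (leq_trans N0).
apply/nbhs_normP; exists (32 * N1 * N2)%:R^-1 => // x /=.
rewrite /ball_ /= sub0r normrN => hx.
have x32 : `|x| <= 32%:R^-1 by apply: le_eps hx => //; nia.
have [L hL] := hN1 x (le_eps N1 x N10 ltac:(nia) hx).
have [W hW] := hN2 x (le_eps N2 x N20 ltac:(nia) hx).
(* Both series, summed along the powers of x, have the same terms. *)
have LW : L = W.
  apply: has_sum_unique (has_sum_diag hL) _.
  apply: eq_has_sum (has_sum_triple_diag hW) => n.
  exact: triple_diagE.
(* Summed over l first, the triple series is the right-hand side. *)
have hrow := has_sum_partition (g := fst) hW.
have hF : has_sum (fun mk => cpow (1 - x) (- (2%:R * b)) *
    appellF1_term b e a c (- (4%:R * x) / (1 - x) ^+ 2)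
      (- (4%:R * x * t) / (1 - x) ^+ 2) mk) W.
  apply: hrow => -[m k].
  apply: (has_sum_emb (phi := fun l => (m, k, l)) (psi := snd)) => //.
    by move=> [mk l] /=; case: (eqVneq mk (m, k)) => // ->; rewrite eqxx.
  by apply: eq_has_sum (has_sum_triple_row a b c e t x32 m k) => l; rewrite /= eqxx.
have C0 := cpow_neq0 (1 - x) (- (2%:R * b)).
rewrite [LHS](has_sum_sumE hL) LW.
have hF' : has_sum (appellF1_term b e a c (- (4%:R * x) / (1 - x) ^+ 2)
      (- (4%:R * x * t) / (1 - x) ^+ 2)) ((cpow (1 - x) (- (2%:R * b)))^-1 * W).
  by apply: eq_has_sum (has_sumZ (cpow (1 - x) (- (2%:R * b)))^-1 hF) => mk; rewrite mulKf.
by rewrite [appellF1 _ _ _ _ _ _](has_sum_sumE hF') mulVKf.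
Qed.
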